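(* Let $k$ be a field of characteristic $0$, let $N_7$ be a seven-dimensional characteristically nilpotent Lie algebra over $k$, and let $N=k\oplus N_7$ be the direct sum of the one-dimensional abelian Lie algebra $k$ and $N_7$. Then the eight-dimensional nilpotent Lie algebra $N$ has two maximal (in dimension) solvable extensions that are not isomorphic to each other. In particular, the following conjecture is false: for every finite-dimensional complex nilpotent Lie algebra, the maximal (in dimension) solvable extension is unique up to isomorphism.
   Context: All Lie algebras are finite-dimensional. The nilradical of a Lie algebra is its largest nilpotent ideal. A solvable extension of a nilpotent Lie algebra $N$ over $k$ is a solvable Lie algebra over $k$ whose nilradical is isomorphic to $N$. A solvable extension of $N$ is maximal (in dimension) if it has the largest dimension among all solvable extensions of $N$. A nilpotent Lie algebra is characteristically nilpotent if its Lie algebra of derivations $Der(N)$ is nilpotent; it is well known that seven-dimensional characteristically nilpotent Lie algebras exist (for example, over $\mathbf{C}$). *)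

(* Defs.v *)
From HB Require Import structures.
From mathcomp Require Import all_boot all_order all_algebra.
From mathcomp Require Import complex reals.

Set Implicit Arguments.
Unset Strict Implicit.
Unset Printing Implicit Defensive.

Import GRing.Theory.
Local Open Scope ring_scope.

HB.mixin Record Vector_isLieAlgebra (k : fieldType) V of Vector k V := {
  lie : V -> V -> V;
  lie_is_linearl : forall y, linear (fun x => lie x y);
  lie_is_linearr : forall x, linear (lie x);
  liexx : forall x, lie x x = 0;
  lie_jacobi : forall x y z,
    lie x (lie y z) + lie y (lie z x) + lie z (lie x y) = 0
}.

#[short(type="lieAlgType")]
HB.structure Definition LieAlgebra (k : fieldType) :=
  {V of Vector k V & Vector_isLieAlgebra k V}.

Section LieBracket.
Variables (k : fieldType) (L : lieAlgType k).
Implicit Types x y : L.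

HB.instance Definition _ x :=
  GRing.isLinear.Build k L L *:%R (lie x) (lie_is_linearr x).

Definition lier y x := lie x y.
HB.instance Definition _ y :=
  GRing.isLinear.Build k L L *:%R (lier y) (lie_is_linearl y).

Lemma lieDl x y z : lie (x + y) z = lie x z + lie y z.
Proof. exact: (raddfD (lier z)). Qed.

Lemma lieZl a x z : lie (a *: x) z = a *: lie x z.
Proof. exact: (linearZ_LR (lier z)). Qed.

Lemma lie_suml I (r : seq I) (P : pred I) (F : I -> L) z :
  lie (\sum_(i <- r | P i) F i) z = \sum_(i <- r | P i) lie (F i) z.
Proof. exact: (raddf_sum (lier z)). Qed.

Lemma lieC x y : lie x y = - lie y x.
Proof.
apply/eqP; rewrite -addr_eq0; have := liexx (x + y).
by rewrite lieDl !raddfD /= !liexx add0r addr0 => ->.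
Qed.

End LieBracket.

Section RegularLie.
Variable k : fieldType.

Definition lie_regular (x y : k^o) : k^o := 0.

Fact lie_regular_linearl y : linear (fun x => lie_regular x y).
Proof. by move=> a u v; rewrite /lie_regular scaler0 addr0. Qed.

Fact lie_regular_linearr x : linear (lie_regular x).
Proof. by move=> a u v; rewrite /lie_regular scaler0 addr0. Qed.

Fact lie_regularxx x : lie_regular x x = 0. Proof. by []. Qed.

Fact lie_regular_jacobi x y z : lie_regular x (lie_regular y z)
  + lie_regular y (lie_regular z x) + lie_regular z (lie_regular x y) = 0.
Proof. by rewrite /lie_regular !addr0. Qed.

HB.instance Definition _ := Vector_isLieAlgebra.Build k k^o
  lie_regular_linearl lie_regular_linearr lie_regularxx lie_regular_jacobi.

End RegularLie.

Section ProdLie.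
Variables (k : fieldType) (L1 L2 : lieAlgType k).
Implicit Types u v : (L1 * L2)%type.

Definition lie_prod u v : (L1 * L2)%type := (lie u.1 v.1, lie u.2 v.2).

Fact lie_prod_linearl v : linear (fun u => lie_prod u v).
Proof. by move=> a [u1 u2] [w1 w2]; rewrite /lie_prod /= !lieDl !lieZl. Qed.

Fact lie_prod_linearr u : linear (lie_prod u).
Proof. by move=> a [v1 v2] [w1 w2]; rewrite /lie_prod /= !linearP. Qed.

Fact lie_prodxx u : lie_prod u u = 0.
Proof. by rewrite /lie_prod !liexx. Qed.

Fact lie_prod_jacobi u v w : lie_prod u (lie_prod v w)
  + lie_prod v (lie_prod w u) + lie_prod w (lie_prod u v) = 0.
Proof. by congr (_, _); rewrite /= lie_jacobi. Qed.

HB.instance Definition _ := Vector_isLieAlgebra.Build k (L1 * L2)%type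
  lie_prod_linearl lie_prod_linearr lie_prodxx lie_prod_jacobi.

End ProdLie.

Section EndLie.
Variables (k : fieldType) (V : vectType k).
Implicit Types f g h : 'End(V).

Definition lie_end f g : 'End(V) := ((f \o g) - (g \o f))%VF.

Fact lie_end_linearl g : linear (fun f => lie_end f g).
Proof.
move=> a f h; rewrite /lie_end comp_lfunDl comp_lfunDr.
by rewrite -comp_lfunZl -comp_lfunZr scalerBr opprD addrACA.
Qed.

Fact lie_end_linearr f : linear (lie_end f).
Proof.
move=> a g h; rewrite /lie_end comp_lfunDl comp_lfunDr.
by rewrite -comp_lfunZl -comp_lfunZr scalerBr opprD addrACA.
Qed.

Fact lie_endxx f : lie_end f f = 0. Proof. exact: subrr. Qed.

Fact lie_end_jacobi f g h : lie_end f (lie_end g h)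
  + lie_end g (lie_end h f) + lie_end h (lie_end f g) = 0.
Proof.
have subC4 (a b c d : 'End(V)) : (a - b) - (c - d) = (a + d) - (b + c).
  by rewrite opprB opprD addrACA.
rewrite /lie_end !comp_lfunDl !comp_lfunDr !comp_lfunNl !comp_lfunNr.
rewrite !comp_lfunA !subC4.
set a := (f \o g \o h)%VF; set b := (f \o h \o g)%VF.
set c := (g \o h \o f)%VF; set d := (h \o g \o f)%VF.
set e := (g \o f \o h)%VF; set i := (h \o f \o g)%VF.
by rewrite (addrC c b) subrKA (addrC e i) subrKA (addrC d a) subrr.
Qed.

HB.instance Definition _ := Vector_isLieAlgebra.Build k 'End(V)
  lie_end_linearl lie_end_linearr lie_endxx lie_end_jacobi.

End EndLie.

Section LieTheory.
Variables (k : fieldType) (L : lieAlgType k).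
Implicit Types U W I J : {vspace L}.

(* The span of all brackets of elements of U and W (see lievP), generated     *)
(* here by brackets of basis vectors only.                                    *)
Definition liev U W : {vspace L} :=
  <<[seq lie u w | u <- vbasis U, w <- vbasis W]>>%VS.

Lemma memv_lie U W u w : u \in U -> w \in W -> lie u w \in liev U W.
Proof.
move=> /coord_vbasis -> /coord_vbasis ->.
rewrite lie_suml memv_suml // => i _.
rewrite lieZl memvZ // raddf_sum memv_suml // => j _.
rewrite /= linearZ memvZ //; apply: memv_span; apply/allpairsP.
by exists ((vbasis U)`_i, (vbasis W)`_j); rewrite !mem_nth ?size_tuple.
Qed.

Lemma lievP U W I :
  reflect (forall u w, u \in U -> w \in W -> lie u w \in I) (liev U W <= I)%VS.
Proof.
apply: (iffP idP) => [/subvP sI u w Uu Ww | UWI]; first exact/sI/memv_lie.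
apply/span_subvP => _ /allpairsP[[u w] /= [Uu Ww ->]].
by apply: UWI; apply: vbasis_mem.
Qed.

Definition lower_central U (n : nat) : {vspace L} := iter n (liev U) U.
Definition derived_series U (n : nat) : {vspace L} :=
  iter n (fun W => liev W W) U.

(* To be used for subalgebras U of L only; for L itself, take U := {:L}.      *)
Definition lie_nilpotent U : Prop := exists n, lower_central U n = 0%VS.
Definition lie_solvable U : Prop := exists n, derived_series U n = 0%VS.

Definition lie_ideal I : bool := (liev {:L} I <= I)%VS.

Definition is_nilradical I : Prop :=
  [/\ lie_ideal I, lie_nilpotent I
    & forall J, lie_ideal J -> lie_nilpotent J -> (J <= I)%VS].

Definition leibniz_defect (x y : L) (D : 'End(L)) : L :=
  D (lie x y) - (lie (D x) y + lie x (D y)).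

Fact leibniz_defect_linear x y : linear (leibniz_defect x y).
Proof.
move=> a D E; rewrite /leibniz_defect !add_lfunE !scale_lfunE.
rewrite lieDl lieZl linearP /= [_ + _ + (_ + _)]addrACA -scalerDr.
by rewrite scalerBr opprD addrACA.
Qed.
HB.instance Definition _ x y := GRing.isLinear.Build k 'End(L) L *:%R
  (leibniz_defect x y) (leibniz_defect_linear x y).

(* Der(L), a subalgebra of 'End(L) under the commutator bracket (see          *)
(* derivations_closed); the Leibniz rule is imposed on basis vectors only,    *)
(* but then holds everywhere (see derivationP).                               *)
Definition derivations : {vspace 'End(L)} :=
  (\bigcap_(i < \dim {:L}) \bigcap_(j < \dim {:L})
     lker (linfun (leibniz_defect (vbasis {:L})`_i (vbasis {:L})`_j)))%VS.

Lemma derivationP (D : 'End(L)) :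
  reflect (forall x y, D (lie x y) = lie (D x) y + lie x (D y))
          (D \in derivations).
Proof.
apply: (iffP idP) => [derD x y | derD]; last first.
  apply/subv_bigcapP => i _; apply/subv_bigcapP => j _.
  by rewrite -memvE memv_ker lfunE /= /leibniz_defect derD subrr.
have {}derD (i j : 'I_(\dim {:L})) (X := vbasis {:L}) :
    D (lie X`_i X`_j) = lie (D X`_i) X`_j + lie X`_i (D X`_j).
  move/subv_bigcapP/(_ i isT)/subv_bigcapP/(_ j isT): derD.
  by rewrite -memvE memv_ker lfunE subr_eq0 => /eqP.
have decomp z : exists c, z = \sum_(i < \dim {:L}) c i *: (vbasis {:L})`_i.
  by exists (coord (vbasis {:L}) ^~ z); apply/coord_vbasis/memvf.
have [[c ->] [d ->]] := (decomp x, decomp y).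
rewrite raddf_sum [D (\sum_i d i *: _)]raddf_sum !raddf_sum -big_split /=.
apply: eq_bigr => j _; rewrite !lie_suml raddf_sum -big_split /=.
apply: eq_bigr => i _.
by rewrite !(lieZl, linearZ) /= derD lieZl !scalerA (mulrC (d j)) -scalerDr.
Qed.

End LieTheory.

Lemma derivations_closed (k : fieldType) (L : lieAlgType k) :
  (liev (derivations L) (derivations L) <= derivations L)%VS.
Proof.
apply/lievP => D E /derivationP derD /derivationP derE.
have lieE x : lie D E x = D (E x) - E (D x) by rewrite !lfun_simp.
apply/derivationP => x y; rewrite !lieE derE derD !linearD /= !derE !derD.
have lieBl u v w : lie (u - v) w = lie u w - lie v w.
  exact: (raddfB (lier w)).
rewrite lieBl linearN -opprD /=.
set a := lie (D (E x)) y; set b := lie (E x) (D y).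
set c := lie (D x) (E y); set d := lie x (D (E y)).
set e := lie (E (D x)) y; set i := lie x (E (D y)).
rewrite (addrC c d) (addrC b i) addrACA (addrACA e) (addrC c b) opprD.
by rewrite (addrACA (a + d)) subrr addr0 opprD (addrACA a).
Qed.

(* U is necessarily a subalgebra, being the image of a morphism.              *)
Definition lie_isom_onto (k : fieldType) (L1 L2 : lieAlgType k)
    (U : {vspace L2}) (f : 'Hom(L1, L2)) : Prop :=
  [/\ {morph f : x y / lie x y >-> lie x y}, lker f = 0%VS & limg f = U].

Definition lie_isomorphic (k : fieldType) (L1 L2 : lieAlgType k) : Prop :=
  exists f : 'Hom(L1, L2), lie_isom_onto {:L2} f.

Definition char_nilpotent (k : fieldType) (N : lieAlgType k) : Prop :=
  lie_nilpotent {:N} /\ lie_nilpotent (derivations N).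

Definition solvable_extension (k : fieldType) (N L : lieAlgType k) : Prop :=
  lie_solvable {:L} /\
  exists2 I : {vspace L}, is_nilradical I
    & exists f : 'Hom(N, L), lie_isom_onto I f.

Definition max_solvable_extension (k : fieldType) (N L : lieAlgType k) : Prop :=
  solvable_extension N L /\
  forall M : lieAlgType k, solvable_extension N M ->
    (\dim {:M} <= \dim {:L})%N.

Definition max_solvable_extension_unique (k : fieldType) : Prop :=
  forall N L1 L2 : lieAlgType k, lie_nilpotent {:N} ->
    max_solvable_extension N L1 -> max_solvable_extension N L2 ->
    lie_isomorphic L1 L2.

(* Main.v *)
Require Import Defs.
From HB Require Import structures.
From mathcomp Require Import all_boot all_order all_algebra.
From mathcomp Require Import complex reals.
From mathcomp Require Import ring zify.

Set Implicit Arguments.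
Unset Strict Implicit.
Unset Printing Implicit Defensive.

Import GRing.Theory.
Local Open Scope ring_scope.

(** Let M be characteristically nilpotent of dimension at least 2, and let N be
the sum of M and a line spanned by e. The two extensions of N are obtained by
adjoining one element h that fixes e and acts on M as a derivation D
([der_ext] applied to [line_der D]): D = 0 for the first, and an outer D for
the second. An outer derivation exists on every nonzero nilpotent algebra
([exists_outer_derivation]).

These are solvable with nilradical N since h has the eigenvalue 1 on the central
vector e ([der_ext_nilradical]). They are not isomorphic
([line_der_ext_not_isomorphic]): in the first one ad h is idempotent, so that
its image x in the second one acts on M by an idempotent derivation a D + ad n;
derivations of M being nilpotent, this one is 0. If a were 0, then x would lie
in the nilradical and could not fix the image of e; hence D is inner, a
contradiction.

It remains to see that no solvable extension L of N has dimension greater than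
dim N + 1 ([solvable_extension_dim]). The center of M lies in [M, M]
([char_nilpotent_center]); from this and the nilpotency of the Lie algebra of
derivations of M it follows that all long products of derivations of M vanish
([char_nilpotent_words]), which is more than their nilpotency one at a time. It
also follows that the e-coordinate of D(e) is a multiplicative function of the
derivation D of N, and that long products of derivations on which it is 0 vanish
([weight0_words]). Composed with the adjoint action of L on N, this character
of L has a kernel of codimension at most one; the kernel acts on N by operators
whose long products vanish, and a descent along its derived series shows that it
is contained in the nilradical.

For the complex numbers the conjecture fails once a characteristically nilpotent
algebra is exhibited: a filiform algebra of dimension 7, all of whose
derivations are strictly triangular ([favre_char_nilpotent]). *)

(** * Linear algebra *)

Lemma exists_functional (k : fieldType) (V : vectType k) (U : {vspace V})
    (z : V) :
  z \notin U ->
  exists phi : 'Hom(V, k^o), phi z = 1 /\ (U <= lker phi)%VS.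
Proof.
move=> Uz; have z0 : z != 0 by apply: contraNneq Uz => ->; apply: mem0v.
have dis : (<[z]> :&: U = 0)%VS.
  apply/eqP; rewrite -subv0; apply/subvP => u /memv_capP[/vlineP[a ->] Uaz].
  rewrite memv0 scaler_eq0 (negPf z0) orbF.
  by apply: contraNT Uz => a0; rewrite -(scalerK a0 z) memvZ.
have fz : free [tuple z] by rewrite seq1_free.
exists (linfun (coord [tuple z] ord0 : V -> k^o) \o daddv_pi <[z]> U)%VF.
rewrite comp_lfunE lfunE daddv_pi_id ?memv_line //; split.
  by have := coord_free ord0 ord0 fz; rewrite eqxx.
apply/subvP => u Uu; rewrite memv_ker comp_lfunE lfunE /=.
have -> : daddv_pi <[z]> U u = 0.
  have := daddv_pi_add dis (subvP (addvSr _ _) _ Uu).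
  rewrite (daddv_pi_id _ Uu); last by rewrite capvC.
  by move/(canRL (addrK _)); rewrite subrr.
by rewrite linear0.
Qed.

Lemma functional_eq0 (k : fieldType) (V : vectType k) (v : V) :
  (forall phi : 'Hom(V, k^o), phi v = 0) -> v = 0.
Proof.
move=> phi0; apply: contraTeq isT; rewrite -memv0 => /exists_functional[phi].
by rewrite phi0 => -[/eqP]; rewrite eq_sym oner_eq0.
Qed.

Lemma dim_lker_functional (k : fieldType) (V : vectType k)
    (phi : 'Hom(V, k^o)) : (\dim {:V} <= (\dim (lker phi)).+1)%N.
Proof.
rewrite -(limg_ker_dim phi {:V}) capfv -addn1 leq_add2l.
by rewrite (leq_trans (dimvS (subvf _))) // dimvf.
Qed.

Lemma linfunE (k : fieldType) (U V : vectType k) (f : U -> V) :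
  linear f -> linfun f =1 f.
Proof.
move=> linf; pose F : {linear U -> V} :=
  HB.pack f (GRing.isLinear.Build k U V *:%R f linf).
exact: (lfunE F).
Qed.

Definition word (k : fieldType) (V : vectType k) (s : seq 'End(V)) : 'End(V) :=
  foldr (fun f g => f \o g)%VF \1%VF s.

Lemma word_nil (k : fieldType) (V : vectType k) (v : V) : word [::] v = v.
Proof. exact: id_lfunE. Qed.

Lemma word_cons (k : fieldType) (V : vectType k) (f : 'End(V)) s v :
  word (f :: s) v = f (word s v).
Proof. exact: comp_lfunE. Qed.

Lemma word_cat (k : fieldType) (V : vectType k) (s t : seq 'End(V)) v :
  word (s ++ t) v = word s (word t v).
Proof. by elim: s => [|f s IH]; rewrite ?word_nil //= !word_cons IH. Qed.

Lemma word_rcons (k : fieldType) (V : vectType k) (s : seq 'End(V)) f v :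
  word (rcons s f) v = word s (f v).
Proof. by rewrite -cats1 word_cat word_cons word_nil. Qed.

(** * Generalities on Lie algebras *)

Section LieGeneralities.
Variables (k : fieldType) (L : lieAlgType k).
Implicit Types (U W I J : {vspace L}) (x y z u : L).

Lemma lie0l x : lie 0 x = 0.
Proof. exact: (linear0 (lier x)). Qed.

Lemma lieDr x y z : lie x (y + z) = lie x y + lie x z.
Proof. exact: linearD. Qed.

Lemma lieNr x y : lie x (- y) = - lie x y.
Proof. exact: linearN. Qed.

Lemma lieZr a x y : lie x (a *: y) = a *: lie x y.
Proof. exact: linearZ. Qed.

Lemma lie_leibniz x y z : lie x (lie y z) = lie (lie x y) z + lie y (lie x z).
Proof.
have /eqP := lie_jacobi x y z.
rewrite -addrA addr_eq0 => /eqP ->; rewrite opprD addrC.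
by rewrite -lieC (lieC z x) linearN opprK.
Qed.

Definition lie_center z : Prop := forall x, lie x z = 0.

Definition ad x : 'End(L) := linfun (lie x).

Lemma adE x y : ad x y = lie x y.
Proof. exact: lfunE. Qed.

Lemma ad_derivation x : ad x \in derivations L.
Proof. by apply/derivationP => y z; rewrite !adE lie_leibniz. Qed.

Lemma derivation_center (D : 'End(L)) u :
  D \in derivations L -> lie_center u -> lie_center (D u).
Proof.
move=> /derivationP derD uC v; have := derD v u.
by rewrite !uC linear0 add0r.
Qed.

Lemma lievS U U' W W' :
  (U <= U')%VS -> (W <= W')%VS -> (liev U W <= liev U' W')%VS.
Proof.
move=> /subvP sU /subvP sW; apply/lievP => u w Uu Ww.
by apply: memv_lie; [apply: sU | apply: sW].
Qed.

Lemma liev0 U : liev U 0 = 0%VS.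
Proof.
apply/eqP; rewrite -subv0; apply/lievP => u w _; rewrite memv0 => /eqP ->.
by rewrite linear0 mem0v.
Qed.

Lemma derived_seriesS U W n :
  (U <= W)%VS -> (derived_series U n <= derived_series W n)%VS.
Proof. by move=> sUW; elim: n => //= n IH; apply: lievS. Qed.

Lemma lower_central_sub U n :
  (liev U U <= U)%VS -> (lower_central U n <= U)%VS.
Proof.
by move=> sU; elim: n => //= n IH; apply: subv_trans (lievS _ IH) sU.
Qed.

Lemma derived_series_lower_central U n :
  (liev U U <= U)%VS -> (derived_series U n <= lower_central U n)%VS.
Proof.
move=> sU; elim: n => //= n IH; apply: lievS => //.
exact: subv_trans IH (lower_central_sub n sU).
Qed.

(** The lower central series is spanned by the brackets [x_1, [x_2, ... u]], so
that the vanishing of long products of operators can be read as nilpotency. *)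
Lemma lower_central_words U W n :
    (forall s u, size s = n -> {subset s <= U} -> u \in U ->
       word (map ad s) u \in W) ->
  (lower_central U n <= W)%VS.
Proof.
elim: n W => [|n IH] W UW.
  by apply/subvP => u Uu; have := UW [::] u; rewrite word_nil; apply.
apply/lievP => x y Ux; suff /subvP sy : (lower_central U n <= ad x @^-1: W)%VS.
  by move=> /sy; rewrite -memv_preim adE.
apply: IH => s u sz sU Uu; rewrite -memv_preim -word_cons.
apply: (UW (x :: s)) => //=; first by rewrite sz.
by move=> v; rewrite inE => /predU1P[-> | /sU].
Qed.

Lemma lie_idealP I :
  reflect (forall x u, u \in I -> lie x u \in I) (lie_ideal I).
Proof.
apply: (iffP (lievP _ _ _)) => idI x u; first exact: idI (memvf x).
by move=> _; apply: idI.
Qed.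

Lemma lie_ideal_liev I J : lie_ideal I -> lie_ideal J -> lie_ideal (liev I J).
Proof.
move=> /lie_idealP idI /lie_idealP idJ; apply/lie_idealP => x u.
suff /subvP sIJ : (liev I J <= ad x @^-1: liev I J)%VS.
  by move/sIJ; rewrite -memv_preim adE.
apply/lievP => v w Iv Jw; rewrite -memv_preim adE lie_leibniz.
by rewrite memvD ?memv_lie ?idI ?idJ.
Qed.

Lemma lie_ideal_derived I n : lie_ideal I -> lie_ideal (derived_series I n).
Proof. by move=> idI; elim: n => //= n IH; apply: lie_ideal_liev. Qed.

Lemma lie_ideal_commutators I : (liev {:L} {:L} <= I)%VS -> lie_ideal I.
Proof. exact/subv_trans/lievS/subvf. Qed.

(** The last nonzero term of the series I, [L, I], [L, [L, I]], ... is
central. *)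
Lemma nilpotent_ideal_center I :
    lie_nilpotent {:L} -> lie_ideal I -> I != 0%VS ->
  exists z, [/\ z \in I, z != 0 & lie_center z].
Proof.
move=> [n nilL] idI I0; pose C j := iter j (liev {:L}) I.
have Cn : C n == 0%VS.
  rewrite -subv0 -nilL /C; elim: (n) => [|j IH]; first exact: subvf.
  exact: lievS.
have CI j : (C j <= I)%VS.
  by elim: j => //= j IH; apply: subv_trans (lievS (subvv _) IH) idI.
have [[|m] C0 mmin] := ex_minnP (ex_intro (fun j => C j == 0%VS) n Cn).
  by rewrite C0 in I0.
have Cm : C m != 0%VS by apply/negP => /mmin; rewrite ltnn.
exists (vpick (C m)); rewrite vpick0 Cm; split=> // [|x].
  by apply: (subvP (CI m)); apply: memv_pick.
apply/eqP; rewrite -memv0 -(eqP C0); apply: memv_lie; first exact: memvf.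
exact: memv_pick.
Qed.

Lemma nilpotent_not_perfect :
    lie_nilpotent {:L} -> (0 < \dim {:L})%N ->
  exists z : L, z \notin liev {:L} {:L}.
Proof.
move=> [n nilL] dimL; suff /subvPn[z _ Cz] : ~~ ({:L} <= liev {:L} {:L})%VS.
  by exists z.
apply: contraL dimL => perfL; rewrite -leqNgt leqn0 dimv_eq0 -subv0 -nilL.
by elim: n {nilL} => //= n IH; apply: subv_trans perfL (lievS _ IH).
Qed.

(** * Derivations of rank one *)

Definition rank1 (phi : 'Hom(L, k^o)) z : 'End(L) :=
  linfun (fun u => (phi u : k) *: z).

Lemma rank1E phi z u : rank1 phi z u = (phi u : k) *: z.
Proof.
by rewrite /rank1 linfunE // => a v w; rewrite linearP /= scalerDl scalerA.
Qed.

(** Both sides of the Leibniz rule at u and v vanish: the right-hand one is the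
bracket of z with phi(u) v - phi(v) u, which lies in the kernel of phi. *)
Lemma rank1_derivation (phi : 'Hom(L, k^o)) z :
    (liev {:L} {:L} <= lker phi)%VS ->
    (forall u, u \in lker phi -> lie z u = 0) ->
  rank1 phi z \in derivations L.
Proof.
move=> /lievP Cphi zker; apply/derivationP => u v; rewrite !rank1E.
have /eqP -> : phi (lie u v) == 0 by rewrite -memv_ker Cphi ?memvf.
pose a : k := phi u; pose b : k := phi v.
have : lie z (a *: v - b *: u) = 0.
  apply: zker; rewrite memv_ker linearB subr_eq0 !linearZ; apply/eqP.
  exact: mulrC.
by rewrite linearB /= !lieZr scale0r lieZl (lieC u z) scalerN => ->.
Qed.

End LieGeneralities.

Arguments ad {k L} x.

(** Jacobson's construction. Let phi kill [L, L] with phi(x) = 1, and let A be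
the centralizer of the kernel of phi, which lies in some term L_j of the lower
central series but not in the next one. For z in A outside L_(j+1) the
derivation u |-> phi(u) z is outer: if it were ad w, then w would centralize the
kernel of phi, so that w is in A, hence in L_j, and z = [w, x] would be in
L_(j+1). *)
Lemma exists_outer_derivation (k : fieldType) (L : lieAlgType k) :
    lie_nilpotent {:L} -> (0 < \dim {:L})%N ->
  exists2 D : 'End(L), D \in derivations L & forall w, D <> ad w.
Proof.
move=> nilL dimL; have [x Cx] := nilpotent_not_perfect nilL dimL.
have [phi [phix kerC]] := exists_functional Cx.
have [n Ln0] := nilL.
pose A : {vspace L} :=
  (\bigcap_(i < \dim (lker phi)) lker (ad (vbasis (lker phi))`_i))%VS.
have AP z : reflect (forall u, u \in lker phi -> lie z u = 0) (z \in A).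
  apply: (iffP idP) => [/subv_bigcapP zA u | zK].
    move=> /coord_vbasis ->; rewrite raddf_sum big1 // => i _.
    rewrite /= lieZr; have := zA i isT.
    rewrite -memvE memv_ker adE lieC oppr_eq0.
    by move/eqP ->; rewrite scaler0.
  apply/subv_bigcapP => i _; rewrite -memvE memv_ker adE lieC oppr_eq0.
  by rewrite zK // vbasis_mem // mem_nth // size_tuple.
have A0 : A != 0%VS.
  have L0 : {:L}%VS != 0%VS by rewrite -dimv_eq0 -lt0n.
  have [z [_ z0 zC]] :=
    nilpotent_ideal_center nilL (lie_ideal_commutators (subvf _)) L0.
  apply: contraNneq z0 => A0; rewrite -memv0 -A0; apply/AP => u _.
  by rewrite lieC zC oppr0.
(* the first term of the lower central series that does not contain A *)
have nA : ~~ (A <= lower_central {:L} n)%VS by rewrite Ln0 subv0.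
have [[|j] Aj jmin] :=
    ex_minnP (ex_intro (fun j => ~~ (A <= lower_central {:L} j)%VS) n nA).
  by rewrite subvf in Aj.
have /subvP sAj : (A <= lower_central {:L} j)%VS.
  by apply: contraT => /jmin; rewrite ltnn.
have [z /AP zker zj] := subvPn Aj.
exists (rank1 phi z); first exact: rank1_derivation.
move=> w Dw; have {}Dw u : lie w u = (phi u : k) *: z.
  by rewrite -adE -Dw rank1E.
have /sAj wj : w \in A.
  by apply/AP => u; rewrite memv_ker Dw => /eqP ->; rewrite scale0r.
apply/negP: zj; apply/negPn; rewrite -[z]scale1r -phix -Dw lieC memvN.
exact: memv_lie (memvf _) wj.
Qed.

(** A central z outside the commutators splits off an abelian summand. With
phi(z) = 1 on that summand and a central z' in the kernel of phi, the rank one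
derivations P = phi z and Q = phi z' satisfy [P, Q] = - Q, so that Q survives
in every term of the lower central series of the derivations. *)
Lemma char_nilpotent_center (k : fieldType) (L : lieAlgType k) (z : L) :
    char_nilpotent L -> (1 < \dim {:L})%N -> lie_center z ->
  z \in liev {:L} {:L}.
Proof.
move=> [nilL [n nilD]] dimL zC; apply: contraT => Cz.
have [phi [phiz kerC]] := exists_functional Cz.
have ker0 : lker phi != 0%VS.
  rewrite -dimv_eq0 -lt0n -ltnS; apply: leq_trans dimL _.
  exact: dim_lker_functional.
have [z' [kz' z'0 zC']] :=
  nilpotent_ideal_center nilL (lie_ideal_commutators kerC) ker0.
have der y : lie_center y -> rank1 phi y \in derivations L.
  by move=> yC; apply: rank1_derivation => // u _; rewrite lieC yC oppr0.
have PQ : lie (rank1 phi z) (rank1 phi z') = - rank1 phi z'.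
  have comp y y' u :
      rank1 phi y (rank1 phi y' u) = ((phi u : k) * (phi y' : k)) *: y.
    by rewrite !rank1E linearZ.
  move: kz'; rewrite memv_ker => /eqP phiz'.
  apply/lfunP => u; rewrite !lfun_simp /= !comp phiz phiz' mulr0 scale0r.
  by rewrite mulr1 sub0r rank1E.
suff: rank1 phi z' \in lower_central (derivations L) n.
  rewrite nilD memv0 => /eqP/lfunP/(_ z).
  rewrite rank1E phiz scale1r zero_lfunE.
  by move/eqP; rewrite (negPf z'0).
elim: n {nilD} => [|n IH]; first exact: der.
by rewrite -memvN -PQ /= memv_lie // der.
Qed.

(** * Derivations of a characteristically nilpotent algebra *)

(** Bracketing the inner derivation of x successively with D_n, ..., D_1 gives
the inner derivation of D_1 ... D_n x. *)
Lemma ad_word_derivations (k : fieldType) (L : lieAlgType k) (s : seq 'End(L))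
    (x : L) :
    {subset s <= derivations L} ->
  ad (word s x) \in lower_central (derivations L) (size s).
Proof.
elim: s => [_|D s IH sD]; first by rewrite word_nil ad_derivation.
have derD : D \in derivations L by apply: sD; rewrite mem_head.
suff -> : ad (word (D :: s) x) = lie D (ad (word s x)).
  by rewrite /= memv_lie // IH // => E sE; apply: sD; rewrite inE sE orbT.
rewrite word_cons; apply/lfunP => y; rewrite !lfun_simp /=.
by rewrite (derivationP _ derD) addrK.
Qed.

(** If Der(L) has class n, products of n derivations map L to the center, and
the center lies in the commutators. By the Leibniz rule a product of 2n
derivations kills [L, L], since n of them meet on one of the two factors. *)
Lemma char_nilpotent_words (k : fieldType) (L : lieAlgType k) :
    char_nilpotent L -> (1 < \dim {:L})%N ->
  exists m, forall s : seq 'End(L),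
    {subset s <= derivations L} -> (m <= size s)%N -> word s = 0.
Proof.
move=> cnL dimL; have [_ [n nilD]] := cnL.
have nil_ge i : (n <= i)%N -> lower_central (derivations L) i = 0%VS.
  by move/subnK <-; elim: (i - n)%N => //= j ->; rewrite liev0.
have center s x : {subset s <= derivations L} -> (n <= size s)%N ->
    lie_center (word s x).
  move=> sD /nil_ge s0 y; have := ad_word_derivations x sD.
  rewrite s0 memv0 => /eqP/lfunP/(_ y).
  rewrite adE zero_lfunE => sxy.
  by rewrite lieC sxy oppr0.
have leibniz s p q x y : {subset s <= derivations L} ->
    {subset p <= derivations L} -> {subset q <= derivations L} ->
    (n + n <= size s + size p + size q)%N ->
    word s (lie (word p x) (word q y)) = 0.
  elim/last_ind: s p q => [|s D IH] p q sD pD qD szn.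
    rewrite word_nil; have [np | pn] := leqP n (size p).
      by rewrite lieC center ?oppr0.
    by rewrite center //; move: szn pn; rewrite add0n; lia.
  have [derD sD'] : D \in derivations L /\ {subset s <= derivations L}.
    by split=> [|E sE]; apply: sD; rewrite mem_rcons inE ?eqxx ?sE ?orbT.
  have consD t :
      {subset t <= derivations L} -> {subset D :: t <= derivations L}.
    by move=> tD E; rewrite inE => /predU1P[-> | /tD].
  have [szp szq] : (n + n <= size s + size (D :: p) + size q)%N /\
      (n + n <= size s + size p + size (D :: q))%N.
    by move: szn; rewrite size_rcons /= !addSn !addnS.
  rewrite word_rcons (derivationP _ derD) linearD /=.
  by rewrite -!word_cons !IH ?addr0 //; apply: consD.
exists (n + n + n)%N => s sD szs; apply/lfunP => x; rewrite zero_lfunE.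
rewrite -(cat_take_drop (n + n) s) word_cat.
have /subvP kill : (liev {:L} {:L} <= lker (word (take (n + n) s)))%VS.
  apply/lievP => u v _ _; rewrite memv_ker -[u]word_nil -[v]word_nil leibniz //.
    by move=> D /mem_take/sD.
  by rewrite size_takel ?addn0 // (leq_trans _ szs) // leq_addr.
apply/eqP; rewrite -memv_ker; apply: kill.
apply: (char_nilpotent_center cnL dimL); apply: center.
  by move=> D /mem_drop/sD.
by rewrite size_drop leq_subRL ?(leq_trans _ szs) // leq_addr.
Qed.

(** * Derivations of the sum of a line and a characteristically nilpotent
algebra *)

Section LineSum.
Variables (k : fieldType) (M : lieAlgType k).
Local Notation N := (k^o * M)%type.
Implicit Types (D E : 'End(N)) (n : M).

Definition line_gen : N := (1, 0).

Lemma line_gen_central : lie_center line_gen.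
Proof.
move=> u; suff -> : lie u line_gen = (lie u.1 1, lie u.2 0) by rewrite linear0.
by [].
Qed.

Definition snd_in : 'Hom(M, N) := linfun (fun n => (0, n)).
Definition snd_out : 'Hom(N, M) := linfun snd.

Lemma snd_inE n : snd_in n = (0, n).
Proof.
by rewrite /snd_in linfunE // => a u v; congr pair; rewrite /= scaler0 addr0.
Qed.

Lemma snd_outE u : snd_out u = u.2.
Proof. exact: lfunE. Qed.

Lemma lie_snd_in u n : lie u (snd_in n) = snd_in (lie u.2 n).
Proof. by rewrite !snd_inE. Qed.

Lemma line_decomp (u : N) : u = (u.1 : k) *: line_gen + snd_in u.2.
Proof.
case: u => a n; rewrite snd_inE; congr pair; rewrite /= ?addr0.
  by rewrite /GRing.scale /= mulr1.
by rewrite scaler0 add0r.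
Qed.

Lemma line_sum_nilpotent : lie_nilpotent {:M} -> lie_nilpotent {:N}.
Proof.
move=> [n nilM]; exists n.+1; apply/eqP; rewrite -subv0.
suff sN i :
    (lower_central {:N} i.+1 <= snd_in @: lower_central {:M} i.+1)%VS.
  by apply: subv_trans (sN n) _; rewrite /= nilM liev0 limg0.
elim: i => [|i IH]; apply/lievP => u w _.
  move=> _; have -> : lie u w = snd_in (lie u.2 w.2) by rewrite snd_inE.
  by rewrite memv_img ?memv_lie ?memvf.
move/(subvP IH)/memv_imgP => [v Lv ->].
by rewrite lie_snd_in memv_img // memv_lie ?memvf.
Qed.

Lemma dim_line_sum : \dim {:N} = (\dim {:M}).+1.
Proof. by rewrite !dimvf. Qed.

Definition corner D : 'End(M) := (snd_out \o D \o snd_in)%VF.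

Lemma cornerE D n : corner D n = (D (snd_in n)).2.
Proof. by rewrite !comp_lfunE snd_outE. Qed.

Lemma snd_corner D u :
  (D u).2 = (u.1 : k) *: (D line_gen).2 + corner D u.2.
Proof. by rewrite cornerE [u in LHS]line_decomp linearD linearZ. Qed.

Lemma corner_derivation D : D \in derivations N -> corner D \in derivations M.
Proof.
move=> /derivationP derD; apply/derivationP => x y; rewrite !cornerE.
have -> : snd_in (lie x y) = lie (snd_in x) (snd_in y) by rewrite !snd_inE.
by rewrite derD !snd_inE.
Qed.

Hypotheses (cnM : char_nilpotent M) (dimM : (1 < \dim {:M})%N).

Lemma line_gen_image D : D \in derivations N ->
  (D line_gen).2 \in liev {:M} {:M}.
Proof.
move=> derD; apply: (char_nilpotent_center cnM dimM) => n.
have := derivation_center derD line_gen_central (snd_in n).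
by move=> /(congr1 snd_out); rewrite linear0 snd_outE !snd_inE.
Qed.

Lemma commutator_image D n : D \in derivations N -> n \in liev {:M} {:M} ->
  D (snd_in n) = snd_in (corner D n).
Proof.
move=> /derivationP derD; rewrite cornerE [RHS]snd_inE.
pose f : 'Hom(M, k^o) := (linfun fst \o D \o snd_in)%VF.
suff /subvP fC : (liev {:M} {:M} <= lker f)%VS.
  move/fC; rewrite memv_ker !comp_lfunE lfunE /= => /eqP fn.
  by rewrite [LHS]surjective_pairing fn.
apply/lievP => x y _ _; rewrite memv_ker !comp_lfunE lfunE /= snd_inE.
have -> : (0, lie x y) = lie (snd_in x) (snd_in y) by rewrite !snd_inE.
by rewrite derD /= !addr0.
Qed.

(** The eigenvalue of a derivation on the line, modulo M; it is multiplicative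
since derivations send the line into its sum with [M, M] and preserve [M, M]. *)
Definition weight D : k := (D line_gen).1.

Lemma weight_comp D E : D \in derivations N -> E \in derivations N ->
  weight (D \o E)%VF = weight D * weight E.
Proof.
move=> derD derE; rewrite /weight comp_lfunE [E _ in LHS]line_decomp.
rewrite linearD linearZ /= commutator_image ?line_gen_image // snd_inE /= addr0.
exact: mulrC.
Qed.

(** Such operators preserve the flag 0 < [M, M] < line + [M, M] < N. On the
first and the last quotient they act through derivations of M, whose long products
vanish, and they map the line into [M, M]. *)
Lemma weight0_words :
  exists m, forall s : seq 'End(N),
    (forall D, D \in s -> D \in derivations N /\ weight D = 0) ->
    (m <= size s)%N -> word s = 0.
Proof.
have [m wordM] := char_nilpotent_words cnM dimM.
exists (m + m.+1)%N => s sD szs.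
have cornerS t : {subset t <= s} -> {subset map corner t <= derivations M}.
  by move=> ts _ /mapP[D /ts/sD[derD _] ->]; apply: corner_derivation.
have e0 D : D \in s -> D line_gen = snd_in (D line_gen).2.
  by case/sD => _ D0; rewrite [LHS]line_decomp [_.1]D0 scale0r add0r.
have cornerC D n : D \in derivations N -> n \in liev {:M} {:M} ->
    corner D n \in liev {:M} {:M}.
  move=> derD; suff /subvP sC :
      (liev {:M} {:M} <= corner D @^-1: liev {:M} {:M})%VS.
    by move/sC; rewrite -memv_preim.
  apply/lievP => x y _ _; rewrite -memv_preim.
  have /derivationP -> := corner_derivation derD.
  by rewrite memvD ?memv_lie ?memvf.
(* modulo [M, M], words act on M through the corners *)
have modC t u : {subset t <= s} ->
    (word t u).2 - word (map corner t) u.2 \in liev {:M} {:M}.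
  elim: t => [_|D t IH ts]; first by rewrite /= !id_lfunE subrr mem0v.
  have /sD[derD _] : D \in s by apply: ts; rewrite mem_head.
  rewrite map_cons !word_cons snd_corner -addrA.
  rewrite memvD ?memvZ ?line_gen_image //.
  rewrite -linearB cornerC //; apply: IH => E tE; apply: ts.
  by rewrite inE tE orbT.
(* words act on [M, M] through the corners *)
have onC t n : {subset t <= s} -> n \in liev {:M} {:M} ->
    word t (snd_in n) = snd_in (word (map corner t) n) /\
    word (map corner t) n \in liev {:M} {:M}.
  elim: t => [_ nC|D t IH ts nC]; first by rewrite /= !id_lfunE.
  have /sD[derD _] : D \in s by apply: ts; rewrite mem_head.
  have [|tn tC] := IH _ nC.
    by move=> E tE; apply: ts; rewrite inE tE orbT.
  by rewrite map_cons !word_cons tn commutator_image // ?cornerC.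
apply/lfunP => u; rewrite zero_lfunE -(cat_take_drop m s) word_cat.
have szd : (m < size (drop m s))%N.
  by rewrite size_drop ltn_subRL -addnS.
have sm : {subset take m s <= s} by move=> D /mem_take.
case Ed : (drop m s) szd => [//|D t]; rewrite ltnS => szt.
have ds : {subset D :: t <= s} by move=> E; rewrite -Ed => /mem_drop.
have Ds : D \in s by apply: ds; rewrite mem_head.
have [derD _] := sD D Ds.
have ts : {subset t <= s} by move=> E tE; apply: ds; rewrite inE tE orbT.
rewrite word_cons; have tC : (word t u).2 \in liev {:M} {:M}.
  have := modC t u ts; rewrite (wordM _ (cornerS _ ts)) ?size_map //.
  by rewrite zero_lfunE subr0.
rewrite [word t u]line_decomp linearD linearZ /= e0 // commutator_image //.
rewrite -linearZ -linearD; set n := (_ + _)%R.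
have nC : n \in liev {:M} {:M} by rewrite memvD ?memvZ ?line_gen_image ?cornerC.
have [-> _] := onC _ n sm nC.
rewrite (wordM _ (cornerS _ sm)) ?zero_lfunE ?linear0 // size_map size_takel //.
by rewrite (leq_trans _ szs) // leq_addr.
Qed.

End LineSum.

(** * Bounding the dimension of a solvable extension *)

Section NilradicalAction.
Variables (k : fieldType) (N L : lieAlgType k) (I : {vspace L}).
Variables (f : 'Hom(N, L)).
Hypotheses (idI : lie_ideal I) (isof : lie_isom_onto I f).

Definition ideal_act (x : L) : 'End(N) := (f^-1 \o ad x \o f)%VF.

Lemma ideal_actK x u : f (ideal_act x u) = lie x (f u).
Proof.
have [_ _ fI] := isof; rewrite !comp_lfunE adE limg_lfunVK // fI.
by apply: (lie_idealP _ idI); rewrite -fI memv_img // memvf.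
Qed.

Lemma isom_onto_inj : injective f.
Proof. by have [_ /eqP/lker0P injf _] := isof. Qed.

Lemma ideal_act_derivation x : ideal_act x \in derivations N.
Proof.
have [fM _ _] := isof; apply/derivationP => u v; apply: isom_onto_inj.
by rewrite linearD /= ideal_actK !fM !ideal_actK lie_leibniz.
Qed.

Lemma ideal_act_word s u :
  f (word (map ideal_act s) u) = word (map ad s) (f u).
Proof.
by elim: s => [|x s IH]; rewrite ?word_nil //= !word_cons ideal_actK IH adE.
Qed.

Lemma ideal_act_lie x y u :
  ideal_act (lie x y) u =
  ideal_act x (ideal_act y u) - ideal_act y (ideal_act x u).
Proof.
by apply: isom_onto_inj; rewrite linearB /= !ideal_actK lie_leibniz addrK.
Qed.

Lemma ideal_act_linear u : linear (fun x => ideal_act x u).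
Proof.
move=> a x y; apply: isom_onto_inj.
by rewrite linearD linearZ /= !ideal_actK lieDl lieZl.
Qed.

End NilradicalAction.

(** The weight of the action on the line is a character of L, with kernel K of
codimension at most one. An ideal J inside K with [J, J] in the nilradical I is
nilpotent, as the action of K on I is, hence J lies in I. By descent along the
derived series of K, K itself lies in I. *)
Lemma solvable_extension_dim (k : fieldType) (M L : lieAlgType k) :
    char_nilpotent M -> (1 < \dim {:M})%N ->
    solvable_extension (k^o * M)%type L ->
  (\dim {:L} <= (\dim {:(k^o * M)%type}).+1)%N.
Proof.
move=> cnM dimM [[n solL] [I [idI _ maxI] [f isof]]].
pose N := (k^o * M)%type; pose act := ideal_act f.
have der x : act x \in derivations N by apply: ideal_act_derivation idI isof x.
pose chi : 'Hom(L, k^o) := linfun (fun x => weight (act x) : k^o).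
have chiE x : chi x = weight (act x).
  rewrite /chi linfunE // => a y z.
  by rewrite /weight [act _ _](ideal_act_linear idI isof).
pose K := lker chi.
have idK : lie_ideal K.
  apply/lie_ideal_commutators/lievP => x y _ _; rewrite memv_ker chiE /weight.
  rewrite [act _ _](ideal_act_lie idI isof).
  have comp z w :
      (act z (act w (line_gen M))).1 = weight (act z) * weight (act w).
    by rewrite -(weight_comp cnM dimM) // /weight comp_lfunE.
  pose e := line_gen M; apply/eqP.
  transitivity ((act x (act y e)).1 - (act y (act x e)).1 : k); first by [].
  by rewrite !comp mulrC subrr.
have [m words0] := weight0_words cnM dimM.
have small J : lie_ideal J -> (J <= K)%VS -> (liev J J <= I)%VS -> (J <= I)%VS.
  move=> idJ /subvP JK /lievP JJ; apply: maxI => //; exists m.+1.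
  apply/eqP; rewrite -subv0; apply: lower_central_words => s u.
  case/lastP: s => [//|s x]; rewrite size_rcons => -[sz] sJ Ju.
  have Jx : x \in J by apply: sJ; rewrite mem_rcons mem_head.
  have [_ _ fI] := isof.
  have := JJ x u Jx Ju; rewrite -fI => /memv_imgP[v _ xu].
  rewrite map_rcons word_rcons adE xu -(ideal_act_word idI isof).
  rewrite words0 ?size_map ?sz // ?zero_lfunE ?linear0 ?mem0v //.
  move=> _ /mapP[y sy ->]; split=> //.
  have /JK : y \in J by rewrite sJ // mem_rcons inE sy orbT.
  by rewrite memv_ker chiE => /eqP.
have KI : (K <= I)%VS.
  have der0 : (derived_series K n <= I)%VS.
    apply: subv_trans (derived_seriesS n (subvf K)) _.
    by rewrite solL sub0v.
  have subK i : (derived_series K i <= K)%VS.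
    elim: i => //= i IH; apply: subv_trans (lievS (subvf _) IH) idK.
  elim: n der0 {solL} => //= n IH der0; apply: IH.
  by apply: small => //; apply: lie_ideal_derived.
have [_ f0 fI] := isof.
rewrite -(limg_dim_eq (_ : {:N} :&: lker f = 0)%VS); last by rewrite f0 capv0.
rewrite fI; apply: leq_trans (dim_lker_functional chi) _.
by rewrite ltnS dimvS.
Qed.

(** * Extending a nilpotent algebra by a derivation *)

(** The semidirect product of k and N, the generator (1, 0) of the line k acting
on N as E. The type depends on the proof that E is a derivation so that the
bracket can be inferred from the type. *)
Definition der_ext (k : fieldType) (N : lieAlgType k) (E : 'End(N))
  (derE : E \in derivations N) : Type := (k^o * N)%type.

HB.instance Definition _ (k : fieldType) (N : lieAlgType k) (E : 'End(N))
  (derE : E \in derivations N) := Vector.on (der_ext derE).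

Section DerExt.
Variables (k : fieldType) (N : lieAlgType k) (E : 'End(N)).
Variable derE : E \in derivations N.
Local Notation L := (der_ext derE).
Implicit Types x y z : L.

Definition der_ext_lie x y : L :=
  (0, (x.1 : k) *: E y.2 - (y.1 : k) *: E x.2 + lie x.2 y.2).

Fact der_ext_lie_linearr x : linear (der_ext_lie x).
Proof.
move=> a u v; congr pair; rewrite /= ?scaler0 ?addr0 //.
rewrite !linearP /= !scalerDl !scalerDr !opprD !scalerN !scalerA.
by rewrite (mulrC a x.1) [RHS]addrACA; congr (_ + _); apply: addrACA.
Qed.

Fact der_ext_liexx x : der_ext_lie x x = 0.
Proof. by rewrite /der_ext_lie subrr liexx addr0. Qed.

Fact der_ext_lieC x y : der_ext_lie x y = - der_ext_lie y x.
Proof.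
by congr pair; rewrite /= ?oppr0 // opprD opprB -lieC.
Qed.

Fact der_ext_lie_linearl y : linear (fun x => der_ext_lie x y).
Proof.
move=> a u v; rewrite !(der_ext_lieC _ y) der_ext_lie_linearr.
by rewrite scalerN opprD.
Qed.

Fact der_ext_lie_jacobi x y z : der_ext_lie x (der_ext_lie y z)
  + der_ext_lie y (der_ext_lie z x) + der_ext_lie z (der_ext_lie x y) = 0.
Proof.
congr pair; rewrite /= ?addr0 // !scale0r !subr0.
have /derivationP derE2 := derE.
have lieE := (lieDr, lieNr, lieZr, derE2).
have ED u v : E (u + v) = E u + E v by apply: linearD.
have EN u : E (- u) = - E u by apply: linearN.
have EZ a u : E (a *: u) = a *: E u by apply: linearZ.
rewrite !(ED, EN, EZ, lieE).
rewrite (lieC (E x.2)) (lieC (E y.2)) (lieC (E z.2)).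
have /(canRL (addrK _)) := lie_jacobi x.2 y.2 z.2.
rewrite sub0r => /(canRL (addrK _)) ->.
(* a module identity, checked on linear functionals *)
apply: functional_eq0 => phi.
move: (E (E x.2)) (E (E y.2)) (E (E z.2)) => xx yy zz.
move: (lie x.2 (E y.2)) (lie x.2 (E z.2)) (lie y.2 (E x.2)) => xy xz yx.
move: (lie y.2 (E z.2)) (lie z.2 (E x.2)) (lie z.2 (E y.2)) => yz zx zy.
move: (lie y.2 _) (lie z.2 _) => jy jz.
have phiD u v : phi (u + v) = (phi u : k) + phi v by apply: (linearD phi).
have phiN u : phi (- u) = - (phi u : k) by apply: (linearN phi).
have phiZ a u : phi (a *: u) = a * (phi u : k) by apply: (linearZ_LR phi).
rewrite !(phiD, phiN, phiZ); ring.
Qed.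

HB.instance Definition _ := Vector_isLieAlgebra.Build k L
  der_ext_lie_linearl der_ext_lie_linearr der_ext_liexx der_ext_lie_jacobi.

Lemma der_ext_lieE x y :
  lie x y = (0, (x.1 : k) *: E y.2 - (y.1 : k) *: E x.2 + lie x.2 y.2) :> L.
Proof. by []. Qed.

Definition der_ext_in : 'Hom(N, L) := linfun (fun u => (0, u) : L).

Lemma der_ext_inE u : der_ext_in u = (0, u).
Proof.
rewrite /der_ext_in linfunE // => a v w.
by congr pair; rewrite /= scaler0 addr0.
Qed.

Lemma der_ext_in_isom : lie_isom_onto (limg der_ext_in) der_ext_in.
Proof.
split=> // [u v|].
  by rewrite !der_ext_inE der_ext_lieE !scale0r subrr add0r.
by apply/eqP/lker0P => u v; rewrite !der_ext_inE => -[].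
Qed.

Lemma mem_der_ext_in x : (x \in limg der_ext_in) = (x.1 == 0).
Proof.
apply/memv_imgP/eqP => [[u _ ->]|x0]; first by rewrite der_ext_inE.
by exists x.2; rewrite ?memvf // der_ext_inE -x0; case: x {x0}.
Qed.

Lemma der_ext_commutators : (liev {:L} {:L} <= limg der_ext_in)%VS.
Proof. by apply/lievP => x y _ _; rewrite mem_der_ext_in. Qed.

Lemma dim_der_ext : \dim {:L} = (\dim {:N}).+1.
Proof. by rewrite !dimvf. Qed.

Hypothesis nilN : lie_nilpotent {:N}.

Lemma der_ext_in_nilpotent : lie_nilpotent (limg der_ext_in).
Proof.
have [n N0] := nilN; have [inM _ _] := der_ext_in_isom; exists n.
apply/eqP; rewrite -subv0 -(limg0 der_ext_in) -N0.
elim: n {N0} => //= n IH; apply/lievP => _ w /memv_imgP[u _ ->].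
move/(subvP IH)/memv_imgP => [v Lv ->]; rewrite -inM.
by rewrite memv_img // memv_lie ?memvf.
Qed.

Lemma der_ext_solvable : lie_solvable {:L}.
Proof.
have [n I0] := der_ext_in_nilpotent; exists n.+1; apply/eqP.
rewrite -subv0 -I0 /derived_series iterSr.
apply: subv_trans (derived_seriesS n der_ext_commutators) _.
apply: derived_series_lower_central.
exact: subv_trans (lievS (subvf _) (subvf _)) der_ext_commutators.
Qed.

(** An eigenvector e of eigenvalue 1 in the center of N satisfies [x, e] = e for
some x in any ideal not contained in N, so such an ideal is not nilpotent. *)
Lemma der_ext_nilradical (e : N) :
  e != 0 -> lie_center e -> E e = e -> is_nilradical (limg der_ext_in).
Proof.
move=> e0 eC Ee; split; last 1 first.
- move=> J /lie_idealP idJ [n J0]; apply/subvP => x Jx.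
  rewrite mem_der_ext_in; apply: contraT => a0.
  pose a : k := x.1; have {}a0 : a != 0 by [].
  have xe : lie x (der_ext_in e) = a *: der_ext_in e.
    rewrite !der_ext_inE der_ext_lieE /= Ee eC scale0r subr0 addr0.
    by congr pair; rewrite scaler0.
  have Je : der_ext_in e \in J.
    rewrite -[der_ext_in e](scalerK a0) -xe memvZ //.
    by rewrite lieC memvN idJ.
  suff : der_ext_in e \in lower_central J n.
    by rewrite J0 memv0 der_ext_inE => /eqP[/eqP]; rewrite (negPf e0).
  elim: n {J0} => //= n IH.
  by rewrite -[der_ext_in e](scalerK a0) -xe memvZ // memv_lie.
- exact/lie_ideal_commutators/der_ext_commutators.
- exact: der_ext_in_nilpotent.
Qed.

Lemma der_ext_extension (e : N) :
  e != 0 -> lie_center e -> E e = e -> solvable_extension N L.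
Proof.
move=> e0 eC Ee; split; first exact: der_ext_solvable.
exists (limg der_ext_in); first exact: der_ext_nilradical e0 eC Ee.
by exists der_ext_in; apply: der_ext_in_isom.
Qed.

End DerExt.

(** * Two maximal extensions *)

Section TwoExtensions.
Variables (k : fieldType) (M : lieAlgType k).
Local Notation N := (k^o * M)%type.

Definition line_der (D : 'End(M)) : 'End(N) :=
  linfun (fun u : N => (u.1, D u.2) : N).

Lemma line_derE D (u : N) : line_der D u = (u.1, D u.2).
Proof. by rewrite /line_der linfunE // => a v w; rewrite /= linearP. Qed.

Lemma line_der_derivation D :
  D \in derivations M -> line_der D \in derivations N.
Proof.
move=> /derivationP derD; apply/derivationP => u v; rewrite !line_derE.
congr pair; rewrite /= ?derD //.
exact: esym (addr0 0).
Qed.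

Lemma line_der_ext_lieE D (derD : line_der D \in derivations N)
    (x y : der_ext derD) (a := x.1 : k) (b := y.1 : k) :
  lie x y =
    (0, (a * y.2.1 - b * x.2.1,
         a *: D y.2.2 - b *: D x.2.2 + lie x.2.2 y.2.2)).
Proof.
rewrite der_ext_lieE !line_derE; congr pair; congr pair => /=.
exact: addr0.
Qed.

Lemma line_der_ext_max D (derD : line_der D \in derivations N) :
    char_nilpotent M -> (1 < \dim {:M})%N ->
  max_solvable_extension N (der_ext derD).
Proof.
move=> cnM dimM; have [nilM _] := cnM; split.
  apply: (@der_ext_extension _ _ _ _ _ (line_gen M)).
  - exact: line_sum_nilpotent.
  - by apply/eqP => -[/eqP]; rewrite oner_eq0.
  - exact: line_gen_central.
  - by rewrite line_derE /= linear0.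
by move=> L extL; rewrite dim_der_ext; apply: solvable_extension_dim.
Qed.

(** With x = (a, (b, n)) the image of h, the derivation a D + ad n of M is
idempotent because ad h is, and nilpotent because all derivations of M are. *)
Lemma line_der_ext_not_isomorphic D
    (der0 : line_der 0 \in derivations N)
    (derD : line_der D \in derivations N) :
    char_nilpotent M -> (1 < \dim {:M})%N ->
    D \in derivations M -> (forall w, D <> ad w) ->
  ~ lie_isomorphic (der_ext der0) (der_ext derD).
Proof.
move=> cnM dimM MD outD [f [fM f0 fT]].
pose h : der_ext der0 := (1, (0, 0)); pose e : der_ext der0 := (0, (1, 0)).
have adh y : lie h y = (0, (y.2.1, 0)).
  rewrite line_der_ext_lieE /= mul1r mulr0 subr0 !zero_lfunE !scaler0.
  by rewrite lie0l subrr addr0.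
pose a : k := (f h).1; pose n : M := (f h).2.2.
pose F : 'End(M) := a *: D + ad n.
pose i m : der_ext derD := (0, (0, m)).
have fhi m : lie (f h) (i m) = i (F m).
  rewrite line_der_ext_lieE /= mulr0 !mul0r subrr scale0r subr0.
  by rewrite add_lfunE scale_lfunE adE.
have FF m : F (F m) = F m.
  have /memv_imgP[y _ yi] : i m \in limg f by rewrite fT memvf.
  have : lie h (lie h y) = lie h y by rewrite !adh.
  by move/(congr1 f); rewrite !fM -yi !fhi => -[].
have F0 m : F m = 0.
  have [j words0] := char_nilpotent_words cnM dimM.
  have MF : F \in derivations M by rewrite memvD ?memvZ ?ad_derivation.
  have Fj : word (nseq j.+1 F) = 0.
    by apply: words0; rewrite ?size_nseq // => _ /nseqP[-> _].
  suff <- : word (nseq j.+1 F) m = F m by rewrite Fj zero_lfunE.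
  elim: (j) => [|i' IH]; first by rewrite word_cons word_nil.
  by rewrite [nseq _ _]/= word_cons IH FF.
have a0 : a != 0.
  apply/eqP => a0; pose y := f e.
  have he : lie (f h) y = y by rewrite -fM adh.
  have y1 : y.1 = 0 by rewrite -he.
  have y2 : y.2.1 = 0.
    by rewrite -he line_der_ext_lieE /= -/a a0 y1 !mul0r subrr.
  have yi : y = i y.2.2 by move: y1 y2; case: (y) => b [c m] /= -> ->.
  have y0 : f e = f 0 by rewrite -/y -he yi fhi F0 linear0.
  move/eqP/lker0P: f0 => /(_ _ _ y0) [/eqP].
  by rewrite oner_eq0.
apply: (outD (- a^-1 *: n)); apply/lfunP => m; have := F0 m.
rewrite add_lfunE scale_lfunE !adE lieZl => /eqP; rewrite addr_eq0 => /eqP Fm.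
by rewrite -[D m](scalerK a0) Fm scaleNr scalerN.
Qed.
End TwoExtensions.

(** * A seven-dimensional characteristically nilpotent algebra *)

(** On a basis e_0, ..., e_6, the filiform algebra with
[e_0, e_i] = e_(i+1) for 0 < i < 6, [e_1, e_2] = e_5, [e_1, e_3] = e_6,
[e_1, e_4] = - e_6 and [e_2, e_3] = e_6. *)
Definition favre (k : fieldType) : Type := 'rV[k]_7.

HB.instance Definition _ (k : fieldType) := Vector.on (favre k).

Section Favre.
Variable k : fieldType.
Local Notation L := (favre k).
Implicit Types (x y z : L) (u v : nat -> k).

Definition coor x (i : nat) : k := x 0 (inord i).

Definition favre_bracket u v (i : nat) : k :=
  match i with
  | 2%N => u 0%N * v 1%N - u 1%N * v 0%N
  | 3%N => u 0%N * v 2%N - u 2%N * v 0%N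
  | 4%N => u 0%N * v 3%N - u 3%N * v 0%N
  | 5%N => u 0%N * v 4%N - u 4%N * v 0%N + (u 1%N * v 2%N - u 2%N * v 1%N)
  | 6%N => u 0%N * v 5%N - u 5%N * v 0%N + (u 1%N * v 3%N - u 3%N * v 1%N)
         - (u 1%N * v 4%N - u 4%N * v 1%N) + (u 2%N * v 3%N - u 3%N * v 2%N)
  | _ => 0
  end.

Definition favre_lie x y : L :=
  \row_(i < 7) favre_bracket (coor x) (coor y) i.

Lemma coorP x y : (forall i, (i < 7)%N -> coor x i = coor y i) -> x = y.
Proof.
move=> xy; apply/rowP => i; have := xy i (ltn_ord i).
by rewrite /coor inord_val.
Qed.

Lemma coorD x y i : coor (x + y) i = coor x i + coor y i.
Proof. by rewrite /coor mxE. Qed.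

Lemma coorN x i : coor (- x) i = - coor x i.
Proof. by rewrite /coor mxE. Qed.

Lemma coorZ a x i : coor (a *: x) i = a * coor x i.
Proof. by rewrite /coor mxE. Qed.

Lemma coor0 i : coor 0 i = 0.
Proof. by rewrite /coor mxE. Qed.

Lemma coor_sum n (F : 'I_n -> L) j :
  coor (\sum_i F i) j = \sum_i coor (F i) j.
Proof. by rewrite /coor summxE. Qed.

Lemma coor_lie x y i :
  (i < 7)%N -> coor (favre_lie x y) i = favre_bracket (coor x) (coor y) i.
Proof. by move=> i7; rewrite /coor mxE inordK. Qed.

Fact favre_lie_linearr x : linear (favre_lie x).
Proof.
move=> a y z; apply: coorP => i i7; rewrite coorD coorZ !coor_lie //.
by do 7 (case: i i7 => [|i] i7; first by
  (rewrite /=; try rewrite !(coorD, coorZ)); ring).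
Qed.

Fact favre_lie_linearl y : linear (fun x => favre_lie x y).
Proof.
move=> a x z; apply: coorP => i i7; rewrite coorD coorZ !coor_lie //.
by do 7 (case: i i7 => [|i] i7; first by
  (rewrite /=; try rewrite !(coorD, coorZ)); ring).
Qed.

Fact favre_liexx x : favre_lie x x = 0.
Proof.
apply: coorP => i i7; rewrite coor0 coor_lie //.
by do 7 (case: i i7 => [|i] i7; first by rewrite /=; ring).
Qed.

Fact favre_lie_jacobi x y z : favre_lie x (favre_lie y z)
  + favre_lie y (favre_lie z x) + favre_lie z (favre_lie x y) = 0.
Proof.
apply: coorP => i i7; rewrite coor0 !coorD !coor_lie //.
by do 7 (case: i i7 => [|i] i7; first by rewrite /= ?coor_lie //=; ring).
Qed.

HB.instance Definition _ := Vector_isLieAlgebra.Build k L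
  favre_lie_linearl favre_lie_linearr favre_liexx favre_lie_jacobi.

Definition favre_basis (i : nat) : L := delta_mx 0 (inord i).

Lemma coor_basis i j : (i < 7)%N -> (j < 7)%N ->
  coor (favre_basis i) j = (j == i)%:R.
Proof.
by move=> i7 j7; rewrite /coor mxE eqxx /= -val_eqE /= !inordK.
Qed.

Lemma favre_bracket_eq u v u' v' i :
  (forall j, (j < 7)%N -> u j = u' j) -> (forall j, (j < 7)%N -> v j = v' j) ->
  favre_bracket u v i = favre_bracket u' v' i.
Proof.
by move=> uu' vv'; do 7 (case: i => [|i]; first by rewrite /= ?uu' ?vv').
Qed.

Local Notation delta i := (fun j : nat => (j == i)%:R : k).

(** The matrix of a derivation solves a linear system. Bracketing with e_0
expresses the rows of index at least 2 through the rows a, b of index 0 and 1;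
in particular the diagonal entry of index i + 1 is i a_0 + b_1. Then
[e_1, e_2] = e_5 gives b_0 = 0 and b_1 = 3 a_0, while [e_1, e_4] = - e_6 gives
b_1 = 2 a_0. *)
Lemma favre_system (d : nat -> nat -> k) :
    (forall i l, (0 < i < 6)%N -> (l < 7)%N -> d i.+1 l =
       favre_bracket (d 0%N) (delta i) l + favre_bracket (delta 0%N) (d i) l) ->
    (forall l, (l < 7)%N -> d 5%N l =
       favre_bracket (d 1%N) (delta 2%N) l
       + favre_bracket (delta 1%N) (d 2%N) l) ->
    (forall l, (l < 7)%N -> - d 6%N l =
       favre_bracket (d 1%N) (delta 4%N) l
       + favre_bracket (delta 1%N) (d 4%N) l) ->
  forall i j, (i < 7)%N -> (j <= i)%N -> d i j = 0.
Proof.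
move=> eq0 eq12 eq14.
have low i l : (i < 5)%N -> (l < i.+2)%N -> d i.+2 l = 0.
  elim: i l => [|i IH] l i5 l_lt; rewrite eq0; try lia.
    by case: l l_lt => [|[|l]] //= _; ring.
  have {}IH l' : (l' < i.+2)%N -> d i.+2 l' = 0 by apply: IH; lia.
  do 4 (case: i i5 l_lt IH => [|i] i5 l_lt IH; first by
    do 6 (case: l l_lt => [|l] l_lt; first by
      rewrite /= ?IH //; ring)).
  by [].
have diag i : (i < 6)%N -> d i.+1 i.+1 = i%:R * d 0%N 0%N + d 1%N 1%N.
  elim: i => [|i IH] i6; first by ring.
  rewrite eq0; try lia; have {IH} := IH (ltnW i6).
  by do 5 (case: i i6 => [|i] i6; first by rewrite /= => ->; ring).
have b0 : d 1%N 0%N = 0.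
  have := eq12 3%N isT; rewrite low //= => /esym <-; ring.
have b1 : d 1%N 1%N = 3 * d 0%N 0%N.
  have /eqP := eq12 5%N isT.
  rewrite -subr_eq0 /= (diag 4%N) // (diag 1%N) // => /eqP e.
  by apply/esym/subr0_eq; rewrite -[RHS]e; ring.
have a0 : d 0%N 0%N = 0.
  have /eqP := eq14 6%N isT.
  rewrite -subr_eq0 /= (diag 5%N) // (diag 3%N) // b1 => /eqP e.
  by rewrite -[RHS]e (low 2%N 3%N) //; ring.
move=> [|[|i]] j i7; rewrite leq_eqVlt => /predU1P[-> | ji] //.
- by rewrite b1 a0 mulr0.
- by case: j ji.
- by rewrite diag // b1 a0 !mulr0 addr0.
- exact: low.
Qed.

Section Derivation.
Variable D : 'End(L).
Hypothesis derD : D \in derivations L.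
Local Notation d i j := (coor (D (favre_basis i)) j).

Lemma favre_leibniz i j a m l :
    (i < 7)%N -> (j < 7)%N -> (m < 7)%N -> (l < 7)%N ->
    lie (favre_basis i) (favre_basis j) = a *: favre_basis m ->
  a * d m l = favre_bracket (coor (D (favre_basis i))) (delta j) l
            + favre_bracket (delta i) (coor (D (favre_basis j))) l.
Proof.
move=> i7 j7 m7 l7 ij.
rewrite -coorZ -linearZ -ij /= (derivationP _ derD) coorD.
by rewrite !coor_lie //; congr (_ + _); apply: favre_bracket_eq => // n n7;
  rewrite coor_basis.
Qed.

Lemma favre_derivation_basis i j :
  (i < 7)%N -> (j <= i)%N -> d i j = 0.
Proof.
have basis_lie i' j' (a : k) m : (i' < 7)%N -> (j' < 7)%N -> (m < 7)%N ->
    (forall l, (l < 7)%N ->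
       favre_bracket (delta i') (delta j') l = a * (l == m)%:R) ->
    lie (favre_basis i') (favre_basis j') = a *: favre_basis m.
  move=> i7 j7 m7 H; apply: coorP => l l7; rewrite coor_lie // coorZ.
  rewrite coor_basis // -H //; apply: favre_bracket_eq => n n7;
  by rewrite coor_basis.
have e0 i' : (0 < i' < 6)%N ->
    lie (favre_basis 0) (favre_basis i') = 1 *: favre_basis i'.+1.
  move=> i6; apply: basis_lie => //; [lia | lia |].
  move=> l l7.
  by do 6 (case: i' i6 => [|i'] i6 //; first by
    do 7 (case: l l7 => [|l] l7; first by rewrite /=; ring)).
have eq0 i' l : (0 < i' < 6)%N -> (l < 7)%N -> d i'.+1 l =
    favre_bracket (coor (D (favre_basis 0))) (delta i') l
    + favre_bracket (delta 0) (coor (D (favre_basis i'))) l.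
  move=> i6 l7; rewrite -[LHS]mul1r; apply: favre_leibniz (e0 _ i6); lia.
apply: (favre_system (d := fun i j => d i j) eq0) => l l7.
  rewrite -[LHS]mul1r; apply: favre_leibniz => //.
  apply: basis_lie => // l' l'7.
  by do 7 (case: l' l'7 => [|l'] l'7; first by rewrite /=; ring).
rewrite -mulN1r; apply: favre_leibniz => //; apply: basis_lie => // l' l'7.
by do 7 (case: l' l'7 => [|l'] l'7; first by rewrite /=; ring).
Qed.

Definition vanish (r : nat) x :=
  forall j, (j < r)%N -> (j < 7)%N -> coor x j = 0.

Lemma favre_derivation_shift r x : vanish r x -> vanish r.+1 (D x).
Proof.
move=> xr j jr j7.
have -> : x = \sum_(i < 7) coor x i *: favre_basis i.
  rewrite [LHS]row_sum_delta; apply: eq_bigr => i _.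
  by rewrite /coor /favre_basis inord_val.
rewrite linear_sum coor_sum big1 // => i _.
rewrite linearZ /= coorZ; have [ir | ri] := ltnP i r.
  by rewrite xr // mul0r.
by rewrite favre_derivation_basis ?mulr0 //; lia.
Qed.

End Derivation.
Lemma vanish7 x : vanish 7 x -> x = 0.
Proof. by move=> x7; apply: coorP => i i7; rewrite x7 // coor0. Qed.

Lemma favre_word_shift (s : seq 'End(L)) x :
  {subset s <= derivations L} -> vanish (size s) (word s x).
Proof.
elim: s => [|D s IH] sD; first by rewrite word_nil.
rewrite word_cons; apply: favre_derivation_shift; first by rewrite sD ?mem_head.
by apply: IH => E sE; apply: sD; rewrite inE sE orbT.
Qed.

(** Derivations, in particular inner ones, lower the flag of the subspaces
[vanish r] by one step, and a bracket of operators lowers it by the sum of the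
steps of its two entries. *)
Lemma favre_char_nilpotent : char_nilpotent L.
Proof.
split.
  exists 7%N; apply/eqP; rewrite -subv0.
  apply: lower_central_words => s u sz _ _.
  rewrite memv0; apply/eqP/vanish7; rewrite -sz -(size_map ad).
  by apply: favre_word_shift => _ /mapP[x _ ->]; apply: ad_derivation.
exists 7%N; apply/eqP; rewrite -subv0.
apply: lower_central_words => s D sz sD DD.
rewrite memv0; apply/eqP/lfunP => x; rewrite zero_lfunE; apply: vanish7 => j j7.
move: (j7); rewrite -sz => js _.
(* D and the derivations in s each contribute one step *)
suff: forall r y, vanish r y -> vanish (r + size s).+1 (word (map ad s) D y).
  by move=> /(_ 0%N x); apply=> //; apply: ltnW.
elim: s sD {sz js} => [|E s IH] sD r y yr.
  by rewrite word_nil addn0; apply: favre_derivation_shift.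
have derE : E \in derivations L by rewrite sD ?mem_head.
have {}IH r' y' : vanish r' y' ->
    vanish (r' + size s).+1 (word (map ad s) D y').
  by apply: IH => F sF; apply: sD; rewrite inE sF orbT.
rewrite map_cons word_cons adE !lfun_simp /= => i.
rewrite addnS => ir i7; rewrite coorD coorN.
have Wy := favre_derivation_shift derE (IH _ _ yr).
have Ey := IH _ _ (favre_derivation_shift derE yr).
by rewrite Wy ?Ey ?subr0.
Qed.

End Favre.

(** * The counterexamples *)

Lemma two_max_solvable_extensions (k : fieldType) (M : lieAlgType k) :
    char_nilpotent M -> (1 < \dim {:M})%N ->
  exists L1 L2 : lieAlgType k,
    [/\ max_solvable_extension (k^o * M)%type L1,
        max_solvable_extension (k^o * M)%type L2 & ~ lie_isomorphic L1 L2].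
Proof.
move=> cnM dimM; have [nilM _] := cnM.
have [D derD outD] := exists_outer_derivation nilM (ltnW dimM).
pose der0 := line_der_derivation (mem0v (derivations M)).
exists (der_ext der0), (der_ext (line_der_derivation derD)).
by split; [apply: line_der_ext_max.. | apply: line_der_ext_not_isomorphic].
Qed.

Theorem mainTheorem2 :
  (forall (k : fieldType) (N7 : lieAlgType k) (N := (k^o * N7)%type),
     [pchar k] =i pred0 -> \dim {:N7} = 7%N -> char_nilpotent N7 ->
     [/\ \dim {:N} = 8%N, lie_nilpotent {:N} &
         exists L1 L2 : lieAlgType k,
           [/\ max_solvable_extension N L1, max_solvable_extension N L2
             & ~ lie_isomorphic L1 L2]]) /\
  (forall R : realType, ~ max_solvable_extension_unique R[i]).
Proof.
split=> [k N7 N _ dim7 cn7 | R uniq].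
  split; first by rewrite dim_line_sum dim7.
    by apply: line_sum_nilpotent; case: cn7.
  by apply: two_max_solvable_extensions; rewrite ?dim7.
have cnF := favre_char_nilpotent R[i].
have dimF : (1 < \dim {:favre R[i]})%N by rewrite dimvf.
have [L1 [L2 [max1 max2]]] := two_max_solvable_extensions cnF dimF.
by apply; apply: uniq max1 max2; apply: line_sum_nilpotent; case: cnF.
Qed.
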